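(* Let $$L=(k+2)^2\sigma^2+(7k^2+21k+16)\sigma-8(k+1)^2,$$ and let $n$ be a positive integer. Then $$\sum_{k=0}^{n-1} L^{\ast}(p(k))(-1)^kf_k \equiv 0 \pmod{2n^2}$$ for any polynomial $p(k)\in\mathbb{Z}[k]$, where $L^{\ast}$ is the adjoint of $L$.
   Context: The Franel numbers are $f_k=\sum_{i=0}^{k}\binom{k}{i}^3$ for $k\ge 0$. $\sigma$ is the shift operator in $k$ ($\sigma F(k)=F(k+1)$). The adjoint of an operator $L=\sum_{i=0}^{J}a_i(k)\sigma^i$ with polynomial coefficients is $L^{\ast}=\sum_{i=0}^{J}\sigma^{-i}a_i(k)$, so that $L^{\ast}(p(k))=\sum_{i=0}^{J}a_i(k-i)p(k-i)$ for a polynomial $p(k)$. *)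

(* Defs.v *)
From mathcomp Require Import all_boot all_order all_algebra.

Set Implicit Arguments.
Unset Strict Implicit.
Unset Printing Implicit Defensive.

Import GRing.Theory.
Local Open Scope ring_scope.

Definition franel (k : nat) : nat := (\sum_(i < k.+1) 'C(k, i) ^ 3)%N.

(* A difference operator a_0(k) + a_1(k) sigma + ... + a_J(k) sigma^J is encoded
   by its list of coefficients [:: a_0; a_1; ...; a_J], the indeterminate 'X
   standing for the variable k. *)
Definition shift_op := seq {poly int}.

(* The power sigma^(-i) acting on polynomials: p(k) |-> p(k - i). *)
Definition unshift (i : nat) (p : {poly int}) : {poly int} :=
  p \Po ('X - i%:R).

(* The action on p of the adjoint sum_i sigma^(-i) a_i(k): multiply by a_i
   first, then shift. *)
Definition adjoint (L : shift_op) (p : {poly int}) : {poly int} :=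
  \sum_(i < size L) unshift i (L`_i * p).

Lemma horner_adjoint (L : shift_op) (p : {poly int}) (x : int) :
  (adjoint L p).[x] =
  \sum_(i < size L) (L`_i).[x - i%:R] * p.[x - i%:R].
Proof.
rewrite /adjoint horner_sum; apply: eq_bigr => i _.
by rewrite /unshift horner_comp !hornerE hornerMn hornerC.
Qed.

Definition franel_op : shift_op :=
  [:: - (8%:R * ('X + 1) ^+ 2);
      7%:R * 'X^2 + 21%:R * 'X + 16%:R;
      ('X + 2%:R) ^+ 2].

(* Main.v *)
(** Zeilberger's algorithm for the summand binomial(n, k)^3 shows that
    F_k = (-1)^k f_k is annihilated by L.  Summation by parts then leaves only
    the boundary terms
      sum_(k < n) L^*(p)(k) F_k = - 8 n^2 p(n-1) F_(n-1) - n^2 p(n-2) F_n,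
    and f_n is even for n > 0 because f_n = sum_i binomial(n, i) = 2^n mod 2. *)
Require Import Defs.
From mathcomp Require Import all_boot all_order all_algebra.
From mathcomp Require Import ring zify.

Import GRing.Theory.
Local Open Scope ring_scope.

Lemma mul_binS_int (n k : nat) :
  (k%:Z + 1) * 'C(n, k.+1)%:Z = (n%:Z - k%:Z) * 'C(n, k)%:Z.
Proof.
have [le_kn|lt_nk] := leqP k n; last first.
  by rewrite !bin_small ?mulr0 // ltnW.
have := mul_bin_left n k; nia.
Qed.

Lemma mul_Sbin_int (n k : nat) :
  (n%:Z + 1 - k%:Z) * 'C(n.+1, k)%:Z = (n%:Z + 1) * 'C(n, k)%:Z.
Proof.
have [le_kn|] := leqP k n.
  by have := mul_bin_down n.+1 k; rewrite /=; nia.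
rewrite leq_eqVlt => /predU1P[<-|lt_nk]; last first.
  by rewrite !bin_small ?mulr0 // ltnW.
by rewrite (@bin_small n n.+1) // mulr0; lia.
Qed.

(** Terms beyond [n] vanish, so consecutive Franel numbers can be summed over one common range. *)
Lemma franel_widen (n m : nat) : (n < m)%N ->
  (franel n)%:Z = \sum_(0 <= i < m) 'C(n, i)%:Z ^+ 3.
Proof.
move=> lt_nm; rewrite (big_cat_nat _ lt_nm) //= [X in _ + X]big_nat_cond.
rewrite [X in _ + X]big1 => [|i /andP[/andP[lt_ni _] _]]; last first.
  by rewrite bin_small // expr0n.
rewrite addr0 big_mkord /franel -natz natr_sum.
by apply: eq_bigr => i _; rewrite natrX natz.
Qed.

(** The operator L in n, with the sign of sigma flipped to absorb (-1)^n, applied to the cube of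
    binomial(n, k). *)
Definition franel_summand (n k : nat) : int :=
  (n%:Z + 2) ^+ 2 * 'C(n.+2, k)%:Z ^+ 3
  - (7 * n%:Z ^+ 2 + 21 * n%:Z + 16) * 'C(n.+1, k)%:Z ^+ 3
  - 8 * (n%:Z + 1) ^+ 2 * 'C(n, k)%:Z ^+ 3.

(* The certificate below is the solution, cubic in k, of the Gosper equation
   for n + 1 times [franel_summand]. *)
Definition franel_cert (n k : int) : int :=
  4 * k ^+ 3 - (18 * n + 30) * k ^+ 2 + (27 * n ^+ 2 + 93 * n + 78) * k
  - (14 * n ^+ 3 + 74 * n ^+ 2 + 128 * n + 72).

Lemma franel_summand_telescope (n k : nat) :
  (n%:Z + 1) * franel_summand n k.+1 =
    franel_cert n (k%:Z + 2) * 'C(n.+1, k.+1)%:Z ^+ 3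
    - franel_cert n (k%:Z + 1) * 'C(n.+1, k)%:Z ^+ 3.
Proof.
(* Up to the factors k + 1 and n + 1, every binomial involved is a polynomial
   multiple of u. *)
have E1 := mul_binS_int n.+1 k; have E0 := mul_Sbin_int n k.+1.
rewrite /franel_summand binS PoszD.
set u := 'C(n.+1, k)%:Z in E1 *; set v := 'C(n.+1, k.+1)%:Z in E0 E1 *.
set w := 'C(n, k.+1)%:Z in E0 *.
have k1_neq0 : (k%:Z + 1) ^+ 3 != 0 by rewrite expf_neq0 //; lia.
have n1_neq0 : (n%:Z + 1) ^+ 3 != 0 by rewrite expf_neq0 //; lia.
apply: (mulfI k1_neq0); apply: (mulfI n1_neq0).
rewrite -[k.+1]addn1 PoszD in E0; rewrite -[n.+1]addn1 PoszD in E1.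
move: k%:Z n%:Z u v w E0 E1 {k1_neq0 n1_neq0} => {}k {}n u v w E0 E1.
have {}E0 : (n + 1) * w = (n - k) * v by rewrite -E0; ring.
have Ew : (n + 1) * (k + 1) * w = (n - k) * (n + 1 - k) * u.
  by rewrite mulrAC mulrC E0 mulrCA E1 mulrA.
have Ev3 : (k + 1) ^+ 3 * v ^+ 3 = (n + 1 - k) ^+ 3 * u ^+ 3.
  by rewrite -exprMn E1; ring.
have Es3 : (k + 1) ^+ 3 * (v + u) ^+ 3 = (n + 2) ^+ 3 * u ^+ 3.
  by rewrite -exprMn mulrDr E1; ring.
have Ew3 : (n + 1) ^+ 3 * (k + 1) ^+ 3 * w ^+ 3
           = ((n - k) * (n + 1 - k)) ^+ 3 * u ^+ 3.
  by rewrite -!exprMn Ew.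
rewrite /franel_cert.
(* Both sides are brought to polynomials in n and k times u^3; what remains is the Gosper equation,
   checked by the last [ring]. *)
transitivity ((n + 1) * ((n + 2) ^+ 2 * (n + 1) ^+ 3 * ((n + 2) ^+ 3 * u ^+ 3)
  - (7 * n ^+ 2 + 21 * n + 16) * (n + 1) ^+ 3 * ((n + 1 - k) ^+ 3 * u ^+ 3)
  - 8 * (n + 1) ^+ 2 * (((n - k) * (n + 1 - k)) ^+ 3 * u ^+ 3))).
  by rewrite -Ev3 -Es3 -Ew3; ring.
transitivity ((n + 1) ^+ 3 * (franel_cert n (k + 2) * ((n + 1 - k) ^+ 3 * u ^+ 3)
   - franel_cert n (k + 1) * ((k + 1) ^+ 3 * u ^+ 3))); last first.
  by rewrite -Ev3 /franel_cert; ring.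
by rewrite /franel_cert; ring.
Qed.

Lemma sum_franel_summand (n m : nat) :
  (n%:Z + 1) * \sum_(0 <= k < m.+1) franel_summand n k =
    franel_cert n (m%:Z + 1) * 'C(n.+1, m)%:Z ^+ 3.
Proof.
elim: m => [|m IHm].
  rewrite big_nat1 /franel_summand /franel_cert !bin0.
  by move: n%:Z => x; ring.
rewrite big_nat_recr //= mulrDr IHm franel_summand_telescope.
by rewrite addrC subrK -[m.+1]addn1 PoszD -addrA.
Qed.

Lemma franel_rec (n : nat) :
  (n%:Z + 2) ^+ 2 * (franel n.+2)%:Z =
    (7 * n%:Z ^+ 2 + 21 * n%:Z + 16) * (franel n.+1)%:Z
    + 8 * (n%:Z + 1) ^+ 2 * (franel n)%:Z.
Proof.
have n1_neq0 : n%:Z + 1 != 0 by lia.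
(* The range up to n + 2 contains all three supports, and the boundary term has the factor
   binomial(n + 1, n + 2) = 0. *)
have := sum_franel_summand n n.+2.
rewrite (@bin_small n.+1) // expr0n mulr0 => /eqP.
rewrite mulf_eq0 (negPf n1_neq0) /= !sumrB -!mulr_sumr.
rewrite -!franel_widen ?ltnS ?leqW //.
by rewrite -addrA -opprD subr_eq0 => /eqP.
Qed.

Lemma odd_franel (n : nat) : odd (franel n) = (n == 0)%N.
Proof.
transitivity (odd (2 ^ n)); last by rewrite oddX orbF.
rewrite -[2%N]/(1 + 1)%N expnDn /franel.
(* Parities agree term by term, since cubing preserves parity. *)
elim/big_ind2: _ => // [x1 x2 y1 y2 Ex Ey|i _].
  by rewrite !oddD Ex Ey.
by rewrite oddX /= !exp1n !muln1.
Qed.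

Lemma horner_adjoint_franel (p : {poly int}) (x : int) :
  (adjoint franel_op p).[x] =
    - 8 * (x + 1) ^+ 2 * p.[x]
    + (7 * (x - 1) ^+ 2 + 21 * (x - 1) + 16) * p.[x - 1]
    + x ^+ 2 * p.[x - 2].
Proof.
rewrite horner_adjoint !big_ord_recl big_ord0 /=.
rewrite -!polyC_natr !(hornerN, hornerM, hornerD, horner_exp, hornerX, hornerC).
rewrite subr0 -![(bump 0 0)%:R]/1 -![(bump 0 _)%:R]/(2 : int).
by ring.
Qed.

Lemma sum_adjoint_franel (p : {poly int}) (n : nat) :
  \sum_(0 <= k < n.+1) (adjoint franel_op p).[k%:Z] * (-1) ^+ k * (franel k)%:Z
  = (-1) ^+ n * (n.+1%:Z ^+ 2 * p.[n%:Z - 1] * (franel n.+1)%:Z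
                 - 8 * n.+1%:Z ^+ 2 * p.[n%:Z] * (franel n)%:Z).
Proof.
elim: n => [|n IHn].
  (* No lower boundary term survives: p(-2) has coefficient 0, and 2 p(-1) equals p(-1) f_1. *)
  have [f0 f1] : franel 0 = 1%N /\ franel 1 = 2%N.
    by rewrite /franel !big_ord_recl !big_ord0.
  by rewrite big_nat1 horner_adjoint_franel !expr0 f0 f1; ring.
rewrite big_nat_recr //= IHn horner_adjoint_franel.
(* The terms in p(n - 1) cancel, those in p(n) combine by the recurrence into a multiple of f_(n+2),
   and the term in p(n + 1) is the new boundary term. *)
have Frec := franel_rec n.
have -> : n.+2%:Z ^+ 2 * p.[n.+1%:Z - 1] * (franel n.+2)%:Z
          = p.[n.+1%:Z - 1] * ((n%:Z + 2) ^+ 2 * (franel n.+2)%:Z).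
  by rewrite -[n.+2]addn2 PoszD; ring.
have -> : n.+1%:Z - 2 = n%:Z - 1 by lia.
have -> : n.+1%:Z - 1 = n%:Z by lia.
rewrite Frec (exprS (-1)) intS -[n.+2]addn2 PoszD.
by ring.
Qed.

Theorem corollary6 (n : nat) (hn : (0 < n)%N) (p : {poly int}) :
  (\sum_(0 <= k < n) (adjoint franel_op p).[k%:Z] * (-1) ^+ k * (franel k)%:Z
     = 0 %[mod 2 * n%:Z ^+ 2])%Z.
Proof.
case: n hn => // n _; rewrite sum_adjoint_franel; apply/eqP.
(* The first boundary term gets its factor 2 from the even f_(n+1); the second has it in its
   coefficient 8, which leaves the 4 in the quotient. *)
have := odd_double_half (franel n.+1); rewrite odd_franel add0n => <-.
rewrite eqz_mod_dvd subr0; apply/dvdzP.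
exists ((-1) ^+ n * (p.[n%:Z - 1] * (franel n.+1)./2%:Z
                    - 4 * p.[n%:Z] * (franel n)%:Z)).
by rewrite -mul2n PoszM; ring.
Qed.
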